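(* Let $\mu,\sigma,X,T,G,V,\mathcal{C},\mathcal{D},\mathbb{L}_X$ be as in the context. Assume: (i) $\mu$ and $\sigma$ are locally Lipschitz, $\mu$ is piecewise-$C^2$, $\sigma>0$ and $\sigma$ is piecewise-$C^3$; (ii) $G:[0,T]\times\mathbb{R}\to\mathbb{R}$ is upper semi-continuous; (iii) $V$ is continuous on $(0,T)\times\mathbb{R}$; (iv) there exists a free-boundary $\{b(t),\,0\le t\le T\}$ such that $\mathcal{C}=\{(t,x): t\in[0,T),\ x>b(t)\}$ and $\mathcal{D}=\{(t,x): t\in[0,T),\ x\le b(t)\}\cup(\{T\}\times\mathbb{R})$; (v) for any $t\in[0,T)$ there exist $\varepsilon>0$ and a ball $\mathcal{B}:=\mathcal{B}^{\varepsilon}_{t,b(t)}$ centered at $(t,b(t))$ with radius $\varepsilon$ such that $G\in C^{1,2}(\overline{\mathcal{B}\cap\mathcal{C}})$; (vi) there exist $\varepsilon>0$ and $\mathcal{B}$ as in (v) (for each $t\in[0,T)$) and a constant $\ell_\varepsilon>0$ such that $H:=G_t+\mathbb{L}_XG\le-\ell_\varepsilon$ in $\overline{\mathcal{B}\cap\mathcal{C}}$; (vii) there exist $\alpha>0$ and continuous functions $\theta_i:\mathbb{R}_+\to\mathbb{R}_+$, $i=1,2$, such that $$\big|V(t+h,x+h')-V(t,x)\big|\le\theta_1(|x|)\,|h|^{\alpha/2}+\theta_2(|t|)\,|h'|^{\alpha}$$ for $(t,x)\in[0,T-h]\times\mathbb{R}$ and $h,h'>0$. Let $[t_1,t_2]\subset[0,T]$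 be a time interval on which the free-boundary $b$ is increasing. Then $t\mapsto b(t)$ is continuous on $[t_1,t_2]$.
   Context: Let $(\Omega,\mathcal{F},\mathsf{P})$ be a complete probability space with the natural filtration $\mathbb{F}=(\mathcal{F}_t)_{t\ge0}$ (completed with $\mathsf{P}$-null sets) of a one dimensional standard Brownian motion $B$. For $\mu:\mathbb{R}\to\mathbb{R}$ and $\sigma:\mathbb{R}\to\mathbb{R}_+$, $X=(X_t)_{t\ge0}$ is the real process that uniquely solves, in the strong sense, $dX_t=\mu(X_t)dt+\sigma(X_t)dB_t$, $X_0=x$. $\mathsf{P}_x$ is the probability measure induced by $X$ started at time zero from $x$, with expectation $\mathsf{E}_x$. Its infinitesimal generator is $\mathbb{L}_Xf(x)=\frac{\sigma^2(x)}{2}f''(x)+\mu(x)f'(x)$, acting on the space variable. Fix $0<T<\infty$ and $G:[0,T]\times\mathbb{R}\to\mathbb{R}$ (the gain function). The value function is $$V(t,x):=\sup_{0\le\tau\le T-t}\mathsf{E}_x\big[G(t+\tau,X_\tau)\big],$$ the supremum being over all $\mathbb{F}$-stopping times in $[0,T-t]$. The continuation set is $\mathcal{C}:=\{V>G\}$ and the stopping set is $\mathcal{D}:=\{V=G\}$. Standing assumptions: the stopping time $\tau_*(t,x):=\inf\{s\ge0: V(t+s,X_s)=G(t+s,X_s)\}\wedge(T-t)$ under $\mathsf{P}_x$ is optimal for $V(t,x)$; $\mathcal{C}$ is open and $\mathcal{D}$ is closed in $[0,T]\times\mathbb{R}$. By standard Markovian arguments $V\in C^{1,2}$ inside $\mathcal{C}$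 and $V_t+\mathbb{L}_XV=0$ in $\mathcal{C}$. ''Increasing'' on an interval means $b(s)\le b(t)$ whenever $s\le t$ in the interval.
   Formalization: When t_2 = T, it is additionally assumed that b(T) equals the left limit b(T-), since (iv) leaves b(T) unconstrained and raising b(T) would otherwise break continuity at T; nothing is added when t_2 < T. *)

(* Defs.v *)
(* Processes are families indexed by all of R, but only nonnegative times are
   used; functions of (t, x) are only used for t in [0, T]. *)
From HB Require Import structures.
From mathcomp Require Export all_boot all_order all_algebra.
From mathcomp Require Export all_classical all_reals all_analysis.

Set Implicit Arguments.
Unset Strict Implicit.
Unset Printing Implicit Defensive.

Export Order.TTheory GRing.Theory Num.Theory.
Export numFieldNormedType.Exports.

Local Open Scope classical_set_scope.
Local Open Scope ring_scope.

Section Regularity.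
Context {R : realType}.

Definition locally_lipschitz (f : R -> R) : Prop :=
  forall x : R, exists2 U, nbhs x U & [lipschitz f y | y in U].

(* The breakpoints form a locally finite (hence closed) set; no condition is
   put on the one-sided limits of the derivatives at the breakpoints. *)
Definition piecewise_C (k : nat) (f : R -> R) : Prop :=
  exists2 S : set R,
    forall a c : R, finite_set (S `&` `[a, c]) &
    forall x, ~ S x ->
      (forall i, (i < k)%N -> derivable (derive1n i f) x 1) /\
      {for x, continuous (derive1n k f)}.

Definition usc_on (A : set (R * R)) (f : R * R -> R) : Prop :=
  forall p, A p -> forall a, f p < a ->
    \forall q \near within A (nbhs p), f q < a.

Definition open_in (A U : set (R * R)) : Prop :=
  exists2 O : set (R * R), open O & U = O `&` A.

Definition closed_in (A F : set (R * R)) : Prop :=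
  exists2 K : set (R * R), closed K & F = K `&` A.

(* Euclidean, whereas the library's [ball] on R * R is the sup-norm one. *)
Definition eball (p : R * R) (e : R) : set (R * R) :=
  [set q | (q.1 - p.1) ^+ 2 + (q.2 - p.2) ^+ 2 < e ^+ 2].

Definition dt (f : R * R -> R) (p : R * R) : R :=
  derive1 (fun s => f (s, p.2)) p.1.
Definition dx (f : R * R -> R) (p : R * R) : R :=
  derive1 (fun y => f (p.1, y)) p.2.
Definition dxx (f : R * R -> R) (p : R * R) : R :=
  derive1n 2 (fun y => f (p.1, y)) p.2.

Definition C12_derivable (f : R * R -> R) (p : R * R) : Prop :=
  [/\ derivable (fun s => f (s, p.2)) p.1 1,
      derivable (fun y => f (p.1, y)) p.2 1 &
      derivable (derive1 (fun y => f (p.1, y))) p.2 1].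

(* U is meant to be open. *)
Definition C12 (U : set (R * R)) (f : R * R -> R) : Prop :=
  forall p, U p ->
    [/\ C12_derivable f p, {for p, continuous (dt f)},
        {for p, continuous (dx f)} & {for p, continuous (dxx f)}].

(* f is in C^{1,2}(closure U): f is continuous on closure U and its derivatives,
   which exist in the interior of U, extend continuously to closure U; the
   extensions are ft, fx and fxx.  The interior is taken in R * R, so that no
   derivative in t is required on the edge t = 0 of the time strip. *)
Definition C12_closure_with (U : set (R * R)) (f ft fx fxx : R * R -> R) : Prop :=
  [/\ {within closure U, continuous f},
      [/\ {within closure U, continuous ft}, {within closure U, continuous fx} &
          {within closure U, continuous fxx}] &
      forall p, interior U p ->
        [/\ C12_derivable f p, ft p = dt f p, fx p = dx f p & fxx p = dxx f p]].

Definition C12_closure (U : set (R * R)) (f : R * R -> R) : Prop :=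
  exists ft fx fxx, C12_closure_with U f ft fx fxx.

(* The generator as a function of the values f1 = f'(x) and f2 = f''(x). *)
Definition generator (mu sigma : R -> R) (x f1 f2 : R) : R :=
  sigma x ^+ 2 / 2 * f2 + mu x * f1.

End Regularity.

Section Processes.
Context {R : realType} {d : measure_display} {Omega : measurableType d}.
Variable P : probability Omega R.

Definition natural_generators (B : R -> Omega -> R) (t : R) :
    set (set Omega) :=
  [set E | exists s : R, exists2 A : set R,
     measurable A & 0 <= s <= t /\ E = B s @^-1` A].

Definition natural_filtration (B : R -> Omega -> R) (t : R) : set (set Omega) :=
  <<s natural_generators B t >>.

Definition completed_filtration (B : R -> Omega -> R) (t : R) :
    set (set Omega) :=
  <<s natural_generators B t `|` P.-negligible >>.

Definition measurable_wrt (F : set (set Omega)) (f : Omega -> R) : Prop :=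
  forall A : set R, measurable A -> F (f @^-1` A).

Definition continuous_paths (Y : R -> Omega -> R) : Prop :=
  {ae P, forall w, {within `[0, +oo[, continuous (Y ^~ w)}}.

Record standard_brownian_motion (B : R -> Omega -> R) : Prop := {
  sbm_measurable : forall t : R, 0 <= t -> measurable_fun [set: Omega] (B t) ;
  sbm_start : {ae P, forall w, B 0 w = 0} ;
  sbm_normal : forall (s t : R) (A : set R), 0 <= s -> s < t -> measurable A ->
    P ((fun w => B t w - B s w) @^-1` A) = normal_prob 0 (Num.sqrt (t - s)) A ;
  sbm_indep : forall (s t : R) (E : set Omega) (A : set R),
    0 <= s -> s < t -> natural_filtration B s E -> measurable A ->
    P (E `&` (fun w => B t w - B s w) @^-1` A) =
    (P E * P ((fun w => (B t w - B s w)%R) @^-1` A))%E ;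
  sbm_continuous : continuous_paths B }.

(* The process \sum_(i < n) xi_i 1_{]t_i, t_{i+1}]}, with 0 <= t_0 <= t_1 ...
   and xi_i bounded and F_{t_i}-measurable. *)
Record simple_process (F : R -> set (set Omega)) := {
  sp_size : nat ;
  sp_time : nat -> R ;
  sp_coef : nat -> Omega -> R ;
  sp_time0 : 0 <= sp_time 0 ;
  sp_time_le : forall i, (i < sp_size)%N -> sp_time i <= sp_time i.+1 ;
  sp_coef_bounded : forall i, (i < sp_size)%N ->
    exists M : R, forall w, `|sp_coef i w| <= M ;
  sp_coef_measurable : forall i, (i < sp_size)%N ->
    measurable_wrt (F (sp_time i)) (sp_coef i) }.

Definition sp_eval F (H : simple_process F) (s : R) (w : Omega) : R :=
  \sum_(i < sp_size H)
    sp_coef H i w * \1_(`]sp_time H i, sp_time H i.+1] : set R) s.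

Definition sp_integral F (B : R -> Omega -> R) (H : simple_process F) (t : R)
    (w : Omega) : R :=
  \sum_(i < sp_size H) sp_coef H i w *
    (B (Num.min (sp_time H i.+1) t) w - B (Num.min (sp_time H i) t) w).

Definition cvg_in_probability0 (Z : nat -> Omega -> \bar R) : Prop :=
  forall e : R, 0 < e -> P [set w | (e%:E <= `|Z n w|)%E] @[n --> \oo] --> 0%E.

(* Z is (a version of) the Ito integral of phi over [0, t] with respect to B:
   the integrals of some simple processes H_n with
   int_0^t (H_n(s) - phi(s))^2 ds --> 0 in probability converge to Z in
   probability.  Z is thereby determined up to a null set. *)
Definition is_ito_integral (F : R -> set (set Omega)) (B phi : R -> Omega -> R)
    (t : R) (Z : Omega -> R) : Prop :=
  exists H : nat -> simple_process F,
    cvg_in_probability0 (fun n w =>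
      (\int[lebesgue_measure]_(s in `[0%R, t])
         ((sp_eval (H n) s w - phi s w) ^+ 2)%R%:E)%E) /\
    cvg_in_probability0 (fun n w => (sp_integral B (H n) t w - Z w)%:E).

(* Strong solution: adapted to the completed filtration of B itself. *)
Record strong_solution (mu sigma : R -> R) (B : R -> Omega -> R) (x : R)
    (Y : R -> Omega -> R) : Prop := {
  sol_adapted : forall t : R, 0 <= t ->
    measurable_wrt (completed_filtration B t) (Y t) ;
  sol_continuous : continuous_paths Y ;
  sol_start : {ae P, forall w, Y 0 w = x} ;
  sol_sde : forall t : R, 0 <= t ->
    is_ito_integral (completed_filtration B) B (fun s w => sigma (Y s w)) t
      (fun w => Y t w - x - \int[lebesgue_measure]_(s in `[0, t]) mu (Y s w)) }.

Definition unique_strong_solution (mu sigma : R -> R) (B : R -> Omega -> R)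
    (x : R) (Y : R -> Omega -> R) : Prop :=
  strong_solution mu sigma B x Y /\
  forall Y', strong_solution mu sigma B x Y' ->
    {ae P, forall w, forall t : R, 0 <= t -> Y' t w = Y t w}.

Definition stopping_time (F : R -> set (set Omega)) (S : R) (tau : Omega -> R) :
    Prop :=
  (forall w, 0 <= tau w <= S) /\
  (forall s : R, 0 <= s -> F s [set w | tau w <= s]).

End Processes.

Section OptimalStopping.
Context {R : realType} {d : measure_display} {Omega : measurableType d}.
Variables (P : probability Omega R) (B : R -> Omega -> R).
(* X x is the process started from x, so that E_x[f(X)] is 'E_P[f(X x)]. *)
Variables (X : R -> R -> Omega -> R) (T : R) (G V : R * R -> R).

Definition strip : set (R * R) := [set p | 0 <= p.1 <= T].

Definition expected_gain (t x : R) (tau : Omega -> R) : \bar R :=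
  ('E_P[fun w => G ((t + tau w)%R, X x (tau w) w)])%E.

Definition value (t x : R) : \bar R :=
  ereal_sup [set expected_gain t x tau | tau in
    stopping_time (completed_filtration P B) (T - t)].

Definition continuation_set : set (R * R) := [set p | strip p /\ G p < V p].

Definition stopping_set : set (R * R) := [set p | strip p /\ V p = G p].

(* Adjoining T - t to the set is the minimum with T - t, with inf of the empty
   set equal to +oo. *)
Definition tau_star (t x : R) (w : Omega) : R :=
  inf ([set s | 0 <= s <= T - t /\
                V (t + s, X x s w) = G (t + s, X x s w)] `|` [set T - t]).

Definition optimal (t x : R) (tau : Omega -> R) : Prop :=
  stopping_time (completed_filtration P B) (T - t) tau /\
  expected_gain t x tau = value t x.

End OptimalStopping.

(* Main.v *)
(** Right-continuity of [b] holds because C is open, so that [b] is upper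
    semi-continuous.  For left-continuity, suppose that [b(t-) < b(t)] with
    [t < T].  On a small rectangle to the left of [t] and below [b(t)], the
    difference [u = V - G] is positive, vanishes at time [t], and satisfies
    [u_t + L u >= ell > 0].  The maximum principle for
    [u - K (x - xm)^2 + c (t - s)], with [K] and [c] small, makes [u] negative
    at [xm] just before [t], a contradiction.  At [t = T] left-continuity is
    the convention defining [b(T)]. *)
Require Import Defs.
From mathcomp Require Import ring lra.

Set Implicit Arguments.
Unset Strict Implicit.
Unset Printing Implicit Defensive.

Local Open Scope classical_set_scope.
Local Open Scope ring_scope.

(** * Conditions at a maximum and a parabolic maximum principle *)

Section MaximumPrinciple.
Context {R : realType}.
Implicit Types (f g : R -> R) (a c l x z : R).

Lemma is_derive_gt0_near_right f x l :
  is_derive x 1 f l -> 0 < l -> \forall h \near 0^'+, f x < f (x + h).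
Proof.
move=> [df fl] l0.
have : (fun h => h^-1 *: (f (h *: 1 + x) - f x)) @ 0^' --> l by rewrite -fl.
move=> /cvgr_gt/(_ _ l0) /= [e e0 H].
near=> h.
have h0 : 0 < h by near: h; exact: nbhs_right_gt.
have := H h; rewrite /ball/= sub0r normrN gtr0_norm//.
have -> : h < e by near: h; exact: nbhs_right_lt.
rewrite gt_eqF// => /(_ isT isT).
by rewrite /GRing.scale /= mulr1 pmulr_rgt0 ?invr_gt0// subr_gt0 addrC.
Unshelve. all: by end_near. Qed.

(** Only later points are compared, because the maximum met in [subsolution_lt0] may sit on the
    initial edge of its rectangle. *)
Lemma is_derive_le0_right_max f x z l : is_derive x 1 f l -> x < z ->
  (forall y, x <= y < z -> f y <= f x) -> l <= 0.
Proof.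
move=> df xz fle; rewrite leNgt; apply/negP => l0.
have /filter_ex[h [/= h0 hz]] : \forall h \near 0^'+, 0 < h /\ (h < z - x /\ f x < f (x + h)).
  near=> h; split; [|split]; near: h.
  - exact: nbhs_right_gt.
  - by apply: nbhs_right_lt; rewrite subr_gt0.
  - exact: is_derive_gt0_near_right df l0.
case: hz => hz; apply/negP; rewrite -leNgt; apply: fle; lra.
Unshelve. all: by end_near. Qed.

(** If [l] were positive, [g], which vanishes at [x], would be positive just to the right of [x]. By
    the mean value theorem [f] would then exceed its maximum there. *)
Lemma is_derive2_interior_max f g a c x l :
  x \in `]a, c[ -> (forall y, y \in `]a, c[ -> is_derive y 1 f (g y)) ->
  is_derive x 1 g l -> (forall y, y \in `]a, c[ -> f y <= f x) ->
  g x = 0 /\ l <= 0.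
Proof.
move=> xac df dg fmax.
have gx0 : g x = 0.
  have ac : a <= c by move: xac; rewrite in_itv/=; lra.
  have dfx y : y \in `]a, c[ -> derivable f y 1 by move=> /df[].
  have [_ f0] := derive1_at_max ac dfx xac fmax.
  by have [_ fg] := df x xac; rewrite -fg f0.
split=> //; rewrite leNgt; apply/negP => l0.
have [e /= e0 ge] := is_derive_gt0_near_right dg l0.
move: xac; rewrite in_itv/= => /andP[ax xc].
pose h := Num.min (e / 2) ((c - x) / 2).
have h0 : 0 < h by rewrite lt_min; apply/andP; split; lra.
have he : h <= e / 2 by rewrite ge_min lexx.
have hc : h <= (c - x) / 2 by rewrite ge_min lexx orbT.
have sub y : y \in `[x, x + h] -> y \in `]a, c[ by rewrite !in_itv/=; lra.
clearbody h; have xh : x < x + h by rewrite ltrDl.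
have fc : {within `[x, x + h], continuous f}.
  by apply: derivable_within_continuous => y /sub /df [].
have dfxh y : y \in `]x, x + h[ -> is_derive y 1 f (g y).
  by move=> /subset_itv_oo_cc /sub /df.
have [k] := MVT xh dfxh fc.
rewrite in_itv/= => kxh fk.
have : g x < g (x + (k - x)).
  apply: ge; last by rewrite /=; lra.
  by rewrite /ball/= sub0r normrN gtr0_norm; lra.
rewrite gx0 addrC subrK => gk.
have : f (x + h) <= f x by apply: fmax; rewrite in_itv/=; lra.
apply/negP; rewrite -ltNge -subr_gt0 fk mulr_gt0//; lra.
Qed.

(** If [u] were nonnegative along [xm], the penalised function [v] would be positive at
    [(t0 - s1, xm)], yet nonpositive at time [t0] and negative on the lateral sides. Its maximum
    over [Q] would thus have [t < t0] and [x] interior, where the derivative conditions contradict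
    the differential inequality. *)
Lemma subsolution_lt0 (mu sigma : R -> R) (u ut ux uxx : R * R -> R)
    (a t0 xm r ell S m : R) :
  a < t0 -> 0 < r -> 0 < ell ->
  (forall x, x \in `[xm - r, xm + r] -> sigma x ^+ 2 <= S /\ `|mu x| <= m) ->
  {within `[a, t0] `*` `[xm - r, xm + r], continuous u} ->
  (forall x, x \in `[xm - r, xm + r] -> u (t0, x) = 0) ->
  (forall t x, t \in `]a, t0[ -> x \in `]xm - r, xm + r[ ->
    [/\ is_derive t 1 (fun s => u (s, x)) (ut (t, x)),
        is_derive x 1 (fun y => u (t, y)) (ux (t, x)),
        is_derive x 1 (fun y => ux (t, y)) (uxx (t, x)) &
        ell <= ut (t, x) + generator mu sigma x (ux (t, x)) (uxx (t, x))]) ->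
  exists2 t, t \in `]a, t0[ & u (t, xm) < 0.
Proof.
move=> at0 r0 ell0 bnd uc ut0 ueq.
apply: contrapT => unneg.
have u_ge0 t : t \in `]a, t0[ -> 0 <= u (t, xm).
  by move=> tI; rewrite leNgt; apply/negP => ult; apply: unneg; exists t.
have [S0 m0] : 0 <= S /\ 0 <= m.
  have [] := bnd xm; first by rewrite in_itv/=; lra.
  by move=> /(le_trans (sqr_ge0 _)) ? /(le_trans (normr_ge0 _)).
(* At the maximum the generator of [u] will be at most [K * (D - 1)], so [K * D = ell / 3] leaves
   room for the time penalty. The summand 1 makes [D] positive. *)
pose D := S + 2 * m * r + 1.
have mr0 : 0 <= m * r by rewrite mulr_ge0// ltW.
have D0 : 0 < D by rewrite /D; lra.
pose K := ell / 3 / D.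
have K0 : 0 < K by rewrite divr_gt0// divr_gt0.
have KD : K * D = ell / 3 by rewrite divfK// gt_eqF.
pose M := K * r ^+ 2.
have M0 : 0 < M by rewrite mulr_gt0// exprn_gt0.
have near_lateral x : x \in `[xm - r, xm + r] ->
    exists2 e : R, 0 < e & forall t, a <= t -> t0 - e < t <= t0 -> u (t, x) < M / 2.
  move=> xI.
  have M20 : u (t0, x) < M / 2 by rewrite ut0//; lra.
  have Qx : (`[a, t0] `*` `[xm - r, xm + r]) (t0, x).
    by split=> //=; rewrite in_itv/=; lra.
  have /subspace_continuousP/(_ _ Qx) := uc.
  move=> /cvgr_lt/(_ _ M20) /nbhs_ballP[e /= e0 He].
  exists e => // t ta tt0; apply: He => /=.
    by split; [rewrite /ball/= ger0_norm; lra | exact: ballxx].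
  by split=> //=; rewrite in_itv/=; lra.
have [|e1 e10 He1] := near_lateral (xm - r); first by rewrite in_itv/=; lra.
have [|e2 e20 He2] := near_lateral (xm + r); first by rewrite in_itv/=; lra.
(* The first two bounds keep [u] below [M / 2] on the lateral sides. The third puts [t0 - s1]
   strictly after [a], so that the equation holds on the initial edge. The last limits the time
   penalty to [M / 3]. *)
pose s1 := Num.min (Num.min (e1 / 2) (e2 / 2)) (Num.min ((t0 - a) / 2) (M / ell)).
have s10 : 0 < s1 by rewrite !lt_min; apply/andP; split; apply/andP; split; rewrite ?divr_gt0//; lra.
have [s1e1 s1e2 s1a s1M] : [/\ s1 <= e1 / 2, s1 <= e2 / 2, s1 <= (t0 - a) / 2 & s1 <= M / ell].
  by rewrite !ge_min !lexx ?orbT.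
have cs1 : ell * s1 <= M by rewrite mulrC -ler_pdivlMr.
pose v := fun p : R * R => u p - K * (p.2 - xm) ^+ 2 + ell / 3 * (t0 - p.1).
pose Q : set (R * R) := `[t0 - s1, t0] `*` `[xm - r, xm + r].
have Q0 : Q !=set0 by exists (t0, xm); split=> /=; rewrite in_itv/=; lra.
have Qc : compact Q by apply: compact_setX; exact: segment_compact.
have vc : {within Q, continuous v}.
  have uQ : {within Q, continuous u}.
    apply: continuous_subspaceW uc => -[t x] [/=]; rewrite !in_itv/= => tI xI.
    by split; lra.
  apply/subspace_continuousP => p Qp.
  have /subspace_continuousP/(_ p Qp) up := uQ.
  have p1 : fst @ within Q (nbhs p) --> p.1 by apply: cvg_within_filter; exact: cvg_fst.
  have p2 : snd @ within Q (nbhs p) --> p.2 by apply: cvg_within_filter; exact: cvg_snd.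
  apply: cvgD; first apply: cvgB => //.
    apply: cvgMr; apply: cvgM; apply: cvgB => //; exact: cvg_cst.
  by apply: cvgMr; apply: cvgB => //; exact: cvg_cst.
have [[t x]] := compact_EVT_max Q0 Qc vc.
rewrite inE => -[/=]; rewrite !in_itv/= => tI xI vmax.
have vpos : 0 < v (t, x).
  have QI : (t0 - s1, xm) \in Q by rewrite inE; split=> /=; rewrite in_itv/=; lra.
  apply: lt_le_trans (vmax _ QI); rewrite /v/=.
  have := u_ge0 (t0 - s1); rewrite in_itv/= => /(_ ltac:(lra)).
  have : 0 < ell * s1 by rewrite mulr_gt0.
  by rewrite subrr expr0n/=; lra.
have et : 0 <= ell * (t0 - t) <= M.
  apply/andP; split; first by rewrite mulr_ge0//; lra.
  by apply: le_trans cs1; rewrite ler_wpM2l//; lra.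
have tlt : t < t0.
  rewrite lt_neqAle; apply/andP; split; last lra.
  apply/eqP => tE; move: vpos; rewrite /v tE/= ut0 ?in_itv/=//.
  by rewrite subrr mulr0 addr0 sub0r oppr_gt0 ltNge mulr_ge0 ?sqr_ge0// ltW.
(* On a lateral side [v] is below [M / 2 - M + M / 3 < 0]. *)
have xlt : xm - r < x < xm + r.
  apply/andP; split; rewrite lt_neqAle; apply/andP; split; try lra.
  - apply/eqP => xE; move: vpos; rewrite /v -xE/=.
    have -> : (xm - r - xm) ^+ 2 = r ^+ 2 by ring.
    by rewrite -/M; have := He1 t; lra.
  - apply/eqP => xE; move: vpos; rewrite /v xE/=.
    have -> : (xm + r - xm) ^+ 2 = r ^+ 2 by ring.
    by rewrite -/M; have := He2 t; lra.
have [||dt_ _ dxx_ pde] := ueq t x; first by rewrite in_itv/=; lra.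
  by rewrite in_itv/=.
have vt : ut (t, x) - ell / 3 <= 0.
  pose l := ut (t, x) - ell / 3.
  have dv : is_derive t 1 (fun s => v (s, x)) l.
    rewrite /v/=; apply: is_derive_eq; rewrite /GRing.scale/= /l; ring.
  apply: (is_derive_le0_right_max dv tlt).
  by move=> y yI; apply: vmax; rewrite inE; split=> /=; rewrite in_itv/=; lra.
have [vx vxx] : ux (t, x) - 2 * K * (x - xm) = 0 /\ uxx (t, x) - 2 * K <= 0.
  pose g y := ux (t, y) - 2 * K * (y - xm).
  pose l := uxx (t, x) - 2 * K.
  have dv y : y \in `]xm - r, xm + r[ ->
      is_derive y 1 (fun y => v (t, y)) (g y).
    move=> yI; have [||_ dy _ _] := ueq t y; [by rewrite in_itv/=; lra|by []|].
    rewrite /v/=; apply: is_derive_eq; rewrite /GRing.scale/= /g; ring.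
  have dv' : is_derive x 1 g l.
    rewrite /g; apply: is_derive_eq; rewrite /GRing.scale/= /l; ring.
  apply: (is_derive2_interior_max _ dv dv'); first by rewrite in_itv.
  move=> y; rewrite in_itv/= => yI; apply: vmax; rewrite inE.
    by split=> /=; rewrite in_itv/=; lra.
have [|Sx mx] := bnd x; first by rewrite in_itv.
have uxE : ux (t, x) = 2 * K * (x - xm) by lra.
(* Here [ut <= ell / 3] and the generator is at most [K * (D - 1) = ell / 3 - K], so their sum stays
   below [ell]. *)
move: pde; rewrite /generator uxE.
have h1 : sigma x ^+ 2 / 2 * uxx (t, x) <= K * S.
  apply: (@le_trans _ _ (sigma x ^+ 2 / 2 * (2 * K))).
    by rewrite ler_wpM2l ?divr_ge0 ?sqr_ge0//; lra.
  have -> : sigma x ^+ 2 / 2 * (2 * K) = K * sigma x ^+ 2 by field.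
  by rewrite ler_pM2l.
have h2 : mu x * (2 * K * (x - xm)) <= K * (2 * m * r).
  have -> : mu x * (2 * K * (x - xm)) = K * (2 * (mu x * (x - xm))) by ring.
  rewrite ler_pM2l// -mulrA ler_pM2l//.
  apply: (le_trans (ler_norm _)); rewrite normrM ler_pM//.
  by rewrite ler_norml; lra.
have : K * D = K * S + K * (2 * m * r) + K by rewrite /D; ring.
lra.
Qed.

End MaximumPrinciple.

(** * One-sided estimates for the free boundary *)

Section FreeBoundary.
Context {R : realType}.

Lemma locally_lipschitz_bounded (f : R -> R) (x : R) : locally_lipschitz f ->
  exists e M : R, 0 < e /\ forall y, `|y - x| < e -> `|f y| <= M.
Proof.
move=> /(_ x)[U /nbhs_ballP[e /= e0 eU] [k [_ /(_ (`|k| + 1))]]].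
(* [lipschitz] provides all constants beyond some [k]; this one is also nonnegative. *)
have k1 : k < `|k| + 1 by rewrite ltr_pwDr// ler_norm.
move=> /(_ k1) fU; exists e, (`|f x| + (`|k| + 1) * e); split=> // y yx.
have Uy : U y by apply: eU; rewrite /ball/= distrC.
have := fU (y, x); rewrite /= => /(_ (conj Uy (eU _ (ballxx _ e0)))) fyx.
rewrite -(subrK (f x) (f y)) addrC; apply: (le_trans (ler_normD _ _)).
rewrite lerD2l; apply: (le_trans fyx); rewrite ler_wpM2l// ltW//.
Qed.

Lemma derivable1_is_deriveB (f g : R -> R) (x : R) :
  derivable f x 1 -> derivable g x 1 ->
  is_derive x 1 (fun y => f y - g y) (derive1 f x - derive1 g x).
Proof. by move=> df dg; rewrite !derive1E; exact: is_deriveB. Qed.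

Lemma generatorB (mu sigma : R -> R) (x f1 f2 g1 g2 : R) :
  generator mu sigma x (f1 - g1) (f2 - g2) =
  generator mu sigma x f1 f2 - generator mu sigma x g1 g2.
Proof. by rewrite /generator; ring. Qed.

(** Denying the conclusion keeps [b] at or below [b t0 - e] on all of [[t1, t0[]. A rectangle [W]
    just left of [t0] and just below [b t0] then lies in the continuation set, while its edge at
    time [t0] lies in the stopping set. Applied to [V - G], [subsolution_lt0] yields [V < G] at a
    point of [W]. *)
Lemma free_boundary_left_adherent (mu sigma : R -> R) (T : R) (G V : R * R -> R)
    (b : R -> R) (t1 t0 e : R) :
  locally_lipschitz mu -> locally_lipschitz sigma ->
  C12 (interior (continuation_set T G V)) V ->
  (forall p, interior (continuation_set T G V) p ->
     dt V p + generator mu sigma p.2 (dx V p) (dxx V p) = 0) ->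
  {within `]0, T[ `*` [set: R], continuous V} ->
  continuation_set T G V = [set p | 0 <= p.1 < T /\ b p.1 < p.2] ->
  stopping_set T G V =
     [set p | 0 <= p.1 < T /\ p.2 <= b p.1] `|` [set p | p.1 = T] ->
  (exists2 eps : R, 0 < eps &
     let U := eball (t0, b t0) eps `&` continuation_set T G V in
     exists Gt Gx Gxx : R * R -> R, C12_closure_with U G Gt Gx Gxx /\
       exists2 ell : R, 0 < ell &
         forall p, closure U p ->
           Gt p + generator mu sigma p.2 (Gx p) (Gxx p) <= - ell) ->
  0 <= t1 < t0 -> t0 < T -> 0 < e ->
  exists2 s, t1 <= s < t0 & b t0 - e < b s.
Proof.
move=> mu_lip sigma_lip V_C12 V_pde V_cont C_eq D_eq.
move=> [eps eps0 /= [Gt [Gx [Gxx [[Gc _ Gder] [ell ell0 Hell]]]]]] t1t0 t0T e0.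
apply: contrapT => nojump.
have b_le s : t1 <= s < t0 -> b s <= b t0 - e.
  by move=> sI; rewrite leNgt; apply/negP => bs; apply: nojump; exists s.
have [e1 [m [e10 mu_bnd]]] := locally_lipschitz_bounded (b t0) mu_lip.
have [e2 [S [e20 sigma_bnd]]] := locally_lipschitz_bounded (b t0) sigma_lip.
(* [e] keeps [W] above the boundary, [t0 - t1] keeps its times after [t1], [eps / 2] on each
   coordinate fits it into the Euclidean ball, and [e1], [e2] give the coefficient bounds. *)
pose del := Num.min (Num.min e (t0 - t1)) (Num.min (eps / 2) (Num.min e1 e2)).
have del0 : 0 < del.
  by rewrite !lt_min e0 e10 e20 subr_gt0 divr_gt0//; move: t1t0 => /andP[_ ->].
have [de dt1 deps de1 de2] :
    [/\ del <= e, del <= t0 - t1, del <= eps / 2, del <= e1 & del <= e2].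
  by rewrite !ge_min !lexx ?orbT.
clearbody del.
have sq (y : R) : - del < y < 0 -> y ^+ 2 <= eps ^+ 2 / 4.
  move=> yI; have -> : eps ^+ 2 / 4 = (eps / 2) ^+ 2 by field.
  by rewrite -sqrrN lerXn2r// ?nnegrE; lra.
pose U := eball (t0, b t0) eps `&` continuation_set T G V.
pose W : set (R * R) := `]t0 - del, t0[ `*` `]b t0 - del, b t0[.
have Wo : open W.
  rewrite openE => -[t x] [/= tI xI].
  exists (`]t0 - del, t0[%classic, `]b t0 - del, b t0[%classic) => //=.
  by split; apply: open_nbhs_nbhs; split=> //; exact: itv_open.
have WC : W `<=` continuation_set T G V.
  move=> [t x] [/=]; rewrite C_eq !in_itv/= => tI xI; split; first lra.
  by apply: (@le_lt_trans _ _ (b t0 - e)); [apply: b_le|]; lra.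
have WU : W `<=` U.
  move=> p Wp; split; last exact: WC.
  case: p Wp => t x [/=]; rewrite !in_itv/= /eball/= => tI xI.
  have := sq (t - t0); have := sq (x - b t0).
  have : 0 < eps ^+ 2 by rewrite exprn_gt0.
  lra.
have WintU : W `<=` interior U by rewrite -open_subsetE.
have WintC : W `<=` interior (continuation_set T G V) by rewrite -open_subsetE.
pose u (p : R * R) : R := V p - G p.
pose ut (p : R * R) : R := dt V p - dt G p.
pose ux (p : R * R) : R := dx V p - dx G p.
pose uxx (p : R * R) : R := dxx V p - dxx G p.
(* The closed rectangle [[a, t0] x [xm - r, xm + r]] keeps a margin of [del / 4] inside [W] except
   at its edge [t = t0]. *)
pose a := t0 - del / 2.
pose xm := b t0 - del / 2.
pose r := del / 4.
(* Points with [t = t0] are outside [U]; a small shift back in time brings them into [W]. This makes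
   [G] continuous up to that edge. *)
have QU : `[a, t0] `*` `[xm - r, xm + r] `<=` closure U.
  move=> [t x] [/=]; rewrite !in_itv/= /a /xm /r => tI xI.
  move=> A /nbhs_ballP[z /= z0 zA].
  pose h := Num.min (z / 2) (del / 4).
  have h0 : 0 < h by rewrite lt_min; apply/andP; split; lra.
  have [hz hd] : h <= z / 2 /\ h <= del / 4 by rewrite !ge_min !lexx ?orbT.
  exists (t - h, x); split.
    by apply: WU; split=> /=; rewrite in_itv/=; lra.
  apply: zA; split=> /=; last exact: ballxx.
  by rewrite /ball/= opprB addrCA subrr addr0 gtr0_norm//; lra.
have [] := @subsolution_lt0 R mu sigma u ut ux uxx a t0 xm r ell (S ^+ 2) m.
- by rewrite /a; lra.
- by rewrite /r; lra.
- by [].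
- move=> x; rewrite in_itv/= /xm /r => xI; split.
    rewrite -real_normK ?num_real// lerXn2r ?nnegrE//.
      by apply: le_trans (sigma_bnd (b t0) _) => //; rewrite subrr normr0.
    by apply: sigma_bnd; rewrite ltr_norml; lra.
  by apply: mu_bnd; rewrite ltr_norml; lra.
- apply: within_continuousB; last exact: continuous_subspaceW Gc.
  apply: continuous_subspaceW V_cont => -[t x] [/=].
  by rewrite !in_itv/= /a => tI _; split=> //=; lra.
- move=> x; rewrite in_itv/= /xm /r => xI.
  have : stopping_set T G V (t0, x) by rewrite D_eq; left=> /=; lra.
  by rewrite /u => -[_ ->]; rewrite subrr.
- move=> t x; rewrite !in_itv/= /a /xm /r => tI xI.
  have Wtx y : b t0 - del < y < b t0 -> W (t, y).
    by move=> yI; split=> /=; rewrite in_itv/=; lra.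
  have Wp : W (t, x) by apply: Wtx; lra.
  have [[Vt Vx Vxx] _ _ _] := V_C12 _ (WintC _ Wp).
  have [[gt gx gxx] GtE GxE GxxE] := Gder _ (WintU _ Wp).
  have := V_pde _ (WintC _ Wp).
  have := Hell _ (subset_closure (WU _ Wp)).
  rewrite GtE GxE GxxE /= => Hp Vp.
  split; last first.
    rewrite lerNr in Hp; apply: le_trans Hp _.
    by rewrite /ut /ux /uxx generatorB addrACA -opprD Vp sub0r.
  + exact: (derivable1_is_deriveB Vxx gxx).
  + exact: (derivable1_is_deriveB Vx gx).
  + exact: (derivable1_is_deriveB Vt gt).
move=> t; rewrite in_itv/= /a => tI; apply/negP; rewrite -leNgt.
have [] : continuation_set T G V (t, xm).
  by apply: WC; split=> /=; rewrite in_itv/= ?/xm; lra.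
by move=> _ GV; rewrite /u subr_ge0 ltW.
Qed.

(** At the horizon the whole line is in the stopping set, so the differential argument says nothing
    about [b T]. Monotonicity and the bound [b T] give a left limit, which the convention identifies
    with [b T]. *)
Lemma nondecreasing_left_adherent (b : R -> R) (t1 T e : R) :
  t1 < T -> {in `[t1, T] &, {homo b : s t / s <= t}} ->
  (forall l : R, b t @[t --> T^'-] --> l -> b T = l) -> 0 < e ->
  exists2 s, t1 <= s < T & b T - e < b s.
Proof.
move=> t1T b_incr bT e0.
have inI s : t1 <= s <= T -> s \in `[t1, T] by rewrite in_itv.
have b_cvg : cvg (b t @[t --> T^'-]).
  apply: nondecreasing_at_left_is_cvgr; near=> x.
    move=> s t; rewrite !in_itv/= => /andP[xs sT] /andP[xt tT].
    by apply: b_incr; apply: inI; apply/andP; split; apply: ltW => //;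
      [apply: lt_trans xs | apply: lt_trans xt]; near: x; exact: nbhs_left_gt.
  exists (b T) => _ [y yI <-]; move: yI; rewrite /= in_itv/= => /andP[xy yT].
  apply: b_incr; rewrite ?inI ?lexx ?(ltW t1T) ?(ltW yT) ?andbT//.
  by apply: ltW; apply: lt_trans xy; near: x; exact: nbhs_left_gt.
have := b_cvg; rewrite -(bT _ b_cvg) => /cvgr_gt/(_ (b T - e)).
rewrite ltrBlDr ltrDl e0 => /(_ isT) bgt.
near (T^'-) => s; exists s.
  apply/andP; split; last by near: s; exact: nbhs_left_lt.
  by near: s; exact: nbhs_left_ge.
by near: s.
Unshelve. all: by end_near. Qed.

(** The point [(t, b t + e)] is in [C], hence so are the points [(s, b t + e)] of the strip with [s]
    close to [t]. *)
Lemma open_epigraph_right_usc (T : R) (C : set (R * R)) (b : R -> R) (t e : R) :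
  open_in (strip T) C -> C = [set p | 0 <= p.1 < T /\ b p.1 < p.2] ->
  0 <= t < T -> 0 < e ->
  exists2 z : R, 0 < z &
    forall s, 0 <= s <= T -> `|t - s| < z -> b s < b t + e.
Proof.
move=> [A Ao CA] C_eq tT e0.
have : C (t, b t + e) by rewrite C_eq /= ltrDl.
rewrite CA => -[At _].
have /nbhs_ballP[z /= z0 zA] : nbhs (t, b t + e) A by exact: open_nbhs_nbhs.
exists z => // s sT ts.
have : C (s, b t + e).
  by rewrite CA; split=> //; apply: zA; split=> //=; exact: ballxx.
by rewrite C_eq => -[].
Qed.

End FreeBoundary.

(** * Continuity on the interval of monotonicity *)

Theorem theorem3p1 (R : realType) (d : measure_display)
  (Omega : measurableType d) (P : probability Omega R)
  (P_complete : measure_is_complete P)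
  (B : R -> Omega -> R) (B_brownian : standard_brownian_motion P B)
  (mu sigma : R -> R) (sigma_ge0 : forall x, 0 <= sigma x)
  (X : R -> R -> Omega -> R)
  (X_sol : forall x, unique_strong_solution P mu sigma B x (X x))
  (T : R) (T_gt0 : 0 < T) (G V : R * R -> R)
  (V_value : forall t x : R, 0 <= t <= T -> (V (t, x))%:E = value P B X T G t x)
  (* standing assumptions *)
  (tau_star_optimal : forall t x : R, 0 <= t <= T ->
     optimal P B X T G t x (tau_star X T G V t x))
  (C_open : open_in (strip T) (continuation_set T G V))
  (D_closed : closed_in (strip T) (stopping_set T G V))
  (V_C12 : C12 (interior (continuation_set T G V)) V)
  (V_pde : forall p, interior (continuation_set T G V) p ->
     dt V p + generator mu sigma p.2 (dx V p) (dxx V p) = 0)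
  (* (i) *)
  (mu_lip : locally_lipschitz mu) (sigma_lip : locally_lipschitz sigma)
  (mu_pC2 : piecewise_C 2 mu)
  (sigma_gt0 : forall x, 0 < sigma x) (sigma_pC3 : piecewise_C 3 sigma)
  (* (ii) *)
  (G_usc : usc_on (strip T) G)
  (* (iii) *)
  (V_cont : {within `]0, T[ `*` [set: R], continuous V})
  (* (iv) *)
  (b : R -> R)
  (C_eq : continuation_set T G V = [set p | 0 <= p.1 < T /\ b p.1 < p.2])
  (D_eq : stopping_set T G V =
     [set p | 0 <= p.1 < T /\ p.2 <= b p.1] `|` [set p | p.1 = T])
  (* (v) *)
  (G_C12 : forall t : R, 0 <= t < T -> exists2 eps : R, 0 < eps &
     C12_closure (eball (t, b t) eps `&` continuation_set T G V) G)
  (* (vi) *)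
  (H_neg : forall t : R, 0 <= t < T -> exists2 eps : R, 0 < eps &
     let U := eball (t, b t) eps `&` continuation_set T G V in
     exists Gt Gx Gxx : R * R -> R, C12_closure_with U G Gt Gx Gxx /\
       exists2 ell : R, 0 < ell &
         forall p, closure U p ->
           Gt p + generator mu sigma p.2 (Gx p) (Gxx p) <= - ell)
  (* (vii) *)
  (alpha : R) (alpha_gt0 : 0 < alpha) (theta1 theta2 : R -> R)
  (theta1_cont : {within `[0, +oo[, continuous theta1})
  (theta1_ge0 : forall r : R, 0 <= r -> 0 <= theta1 r)
  (theta2_cont : {within `[0, +oo[, continuous theta2})
  (theta2_ge0 : forall r : R, 0 <= r -> 0 <= theta2 r)
  (V_holder : forall t x h h' : R, 0 < h -> 0 < h' -> 0 <= t <= T - h ->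
     `|V (t + h, x + h') - V (t, x)| <=
       theta1 `|x| * `|h| `^ (alpha / 2) + theta2 `|t| * `|h'| `^ alpha)
  (* the interval of monotonicity *)
  (t1 t2 : R) (t1_ge0 : 0 <= t1) (t1_le_t2 : t1 <= t2) (t2_leT : t2 <= T)
  (b_incr : {in `[t1, t2] &, {homo b : s t / s <= t}})
  (* b T, which (iv) leaves undetermined, is the left limit of b *)
  (bT : t2 = T -> forall l : R, b t @[t --> T^'-] --> l -> b T = l) :
  {within `[t1, t2], continuous b}.
Proof.
have left_adh t e : t1 < t <= t2 -> 0 < e ->
    exists2 s, t1 <= s < t & b t - e < b s.
  move=> /andP[t1t tt2] e0.
  have [tT|Tt] := ltP t T.
    apply: (@free_boundary_left_adherent R mu sigma T G V) => //.
      by apply: H_neg; rewrite tT (le_trans t1_ge0)// ltW.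
    by rewrite t1_ge0.
  have t2T : t2 = T by apply/eqP; rewrite eq_le t2_leT (le_trans Tt).
  have tT : t = T by apply/eqP; rewrite eq_le Tt -t2T tt2.
  move: t1t b_incr; rewrite tT t2T => t1T bi.
  exact: nondecreasing_left_adherent (bT t2T) e0.
apply/subspace_continuousP => t tI.
have /andP[t1t tt2] : t1 <= t <= t2 by move: tI; rewrite /= in_itv.
apply/cvgrPdist_lt => e e0.
have [zl zl0 bl] : exists2 z : R, 0 < z &
    forall s, t1 <= s <= t -> `|t - s| < z -> b t - e < b s.
  have [t1lt|tle] := ltP t1 t; last first.
    (* At [t = t1] the only candidate is [s = t], so any radius works. *)
    exists 1 => // s /andP[t1s st] _.
    have -> : s = t by apply/eqP; rewrite eq_le st (le_trans tle).
    by rewrite ltrBlDr ltrDl.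
  have [|s0 /andP[t1s0 s0t] bs0] := left_adh t e _ e0; first by rewrite t1lt.
  (* Monotonicity carries the lower bound from the single time [s0] to all of [[s0, t]]. *)
  exists (t - s0); first by rewrite subr_gt0.
  move=> s /andP[t1s st]; rewrite ger0_norm ?subr_ge0// ltrD2l ltrN2 => s0s.
  apply: lt_le_trans bs0 _; apply: b_incr (ltW s0s); rewrite in_itv/= ?t1s ?t1s0/=.
    exact: le_trans (ltW s0t) tt2.
  exact: le_trans st tt2.
have [zr zr0 br] : exists2 z : R, 0 < z &
    forall s, t <= s <= t2 -> `|t - s| < z -> b s < b t + e.
  have [tT|Tt] := ltP t T.
    have [|z z0 bz] := open_epigraph_right_usc C_open C_eq _ e0 (t := t).
      by rewrite tT (le_trans t1_ge0).
    exists z => // s /andP[ts st2]; apply: bz.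
    by rewrite (le_trans _ ts) ?(le_trans t1_ge0)//= (le_trans st2).
  (* At [t = T] the interval has no later time. *)
  exists 1 => // s /andP[ts st2] _.
  have -> : s = t.
    by apply/eqP; rewrite eq_le ts (le_trans st2)// (le_trans t2_leT).
  by rewrite ltrDl.
have z0 : 0 < Num.min zl zr by rewrite lt_min zl0.
apply/nbhs_ballP; exists (Num.min zl zr) => // s.
rewrite /ball/= lt_min in_itv/= => /andP[szl szr] /andP[t1s st2].
have tI' : t \in `[t1, t2] by rewrite in_itv/= t1t.
have sI' : s \in `[t1, t2] by rewrite in_itv/= t1s.
have [st|ts] := leP s t.
  rewrite ger0_norm ?subr_ge0; last exact: b_incr.
  by rewrite ltrBlDr -ltrBlDl; apply: bl; rewrite ?t1s.
rewrite ler0_norm ?subr_le0; last by apply: b_incr => //; exact: ltW.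
by rewrite opprB ltrBlDl; apply: br; rewrite ?(ltW ts).
Qed.
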